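(* Let $p$ be a prime number, let $K$ be a field with embeddings into $\mathbb{R}$ and $\mathbb{Q}_p$, and let $\alpha\in K$. For $n\ge 0$ let $p_n/q_n$ be the $n$-th convergent of $\alpha$ obtained from the algorithm described in the context. Then, in $\mathbb{Q}_p$, $$\lim_{n\to\infty}\frac{p_n}{q_n}=\alpha_{\langle p\rangle}.$$
   Context: Let $p$ be a prime and $K$ a field with field embeddings $\sigma_\infty:K\to\mathbb{R}$ and $\sigma_p:K\to\mathbb{Q}_p$. For $\alpha\in K$ write $\alpha_\infty=\sigma_\infty(\alpha)$, $\alpha_{\langle p\rangle}=\sigma_p(\alpha)$. For $u=\sum_{n}c_np^n\in\mathbb{Q}_p$ with digits $c_n\in\{0,\dots,p-1\}$ ($c_n=0$ for $n<v_p(u)$), put $\lfloor u\rfloor_p=\sum_{n\le 0}c_np^n\in\mathbb{Z}[1/p]$. For $\alpha\in K$ let $b^{(0)}(\alpha)=mp+\lfloor\alpha_{\langle p\rangle}\rfloor_p$, where $m$ is the smallest among the integers $i$ minimizing $|\alpha_\infty-ip-\lfloor\alpha_{\langle p\rangle}\rfloor_p|$; let $b^{(1)}(\alpha)=m'+\lfloor\alpha_{\langle p\rangle}\rfloor_p$, where $m'$ is the smallest among the integers $i$ minimizing $|\alpha_\infty-i-\lfloor\alpha_{\langle p\rangle}\rfloor_p|$. For $\epsilon\in\{0,1\}$ let $F_{p,\epsilon}(\alpha)=\frac{1}{\alpha-b^{(\epsilon)}(\alpha)}$, undefined if $\alpha=b^{(\epsilon)}(\alpha)$. Algorithm: $\alpha_0=\alpha$;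 for $n\ge0$ put $\epsilon=0$ if $n$ is even and $\epsilon=1$ if $n$ is odd, $b_n(\alpha)=b^{(\epsilon)}(\alpha_n)$ and $\alpha_{n+1}=F_{p,\epsilon}(\alpha_n)$; the algorithm halts if $F_{p,\epsilon}(\alpha_n)$ is undefined. Convergents: $p_{-1}=1$, $q_{-1}=0$ and, for $n\ge0$ (as long as $b_n(\alpha)$ is defined), $$\begin{pmatrix} p_n & p_{n-1} \\ q_n & q_{n-1} \end{pmatrix}=\begin{pmatrix} b_0(\alpha) & 1 \\ 1 & 0 \end{pmatrix}\cdots\begin{pmatrix} b_n(\alpha) & 1 \\ 1 & 0 \end{pmatrix}.$$ One has $q_n\neq0$ for all such $n\ge0$. If the algorithm halts, so that there are only finitely many convergents $p_0/q_0,\dots,p_N/q_N$, the limit is understood as the last convergent $p_N/q_N$. *)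

(* Defs.v *)
From HB Require Import structures.
From mathcomp Require Import all_boot all_order all_algebra.
From mathcomp Require Import ring_quotient generic_quotient.
From mathcomp Require Import all_classical all_reals topology.
From mathcomp Require Import ring lra zify.
Set Implicit Arguments.
Unset Strict Implicit.
Unset Printing Implicit Defensive.
Import Order.TTheory GRing.Theory Num.Theory.
Local Open Scope ring_scope.
(* junk value at 0; [padic_absq] treats 0 separately *)
Definition padic_valq (p : nat) (x : rat) : int :=
  (logn p `|numq x|)%:Z - (logn p `|denq x|)%:Z.

Definition padic_absq (p : nat) (x : rat) : rat :=
  if x == 0 then 0 else p%:R ^ (- padic_valq p x).

Section Absq.
Variables (p : nat) (p_pr : prime p).
Local Notation vq := (padic_valq p).
Local Notation absq := (padic_absq p).

Let p_gt0 : 0 < p%:R :> rat. Proof. by rewrite ltr0n prime_gt0. Qed.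
Let p_gt1 : 1 < p%:R :> rat. Proof. by rewrite ltr1n prime_gt1. Qed.

Lemma padic_valq_frac (a b : int) : a != 0 -> b != 0 ->
  vq (a%:Q / b%:Q) = (logn p `|a|)%:Z - (logn p `|b|)%:Z.
Proof.
move=> a0 b0; set x := _ / _.
have x0 : x != 0 by rewrite mulf_neq0 ?invr_eq0 ?intr_eq0.
have E : numq x * b = a * denq x.
  apply: (@intr_inj rat); rewrite !intrM.
  have: x * b%:~R = a%:~R by rewrite /x divfK ?intr_eq0.
  rewrite -{1}(divq_num_den x) => <-; field.
  by rewrite intr_eq0 denq_neq0.
have := congr1 (fun i : int => logn p `|i|) E.
rewrite !abszM !lognM ?absz_gt0 ?numq_eq0 ?denq_neq0 //.
by rewrite /padic_valq; lia.
Qed.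

Lemma padic_absq0 : absq 0 = 0. Proof. by rewrite /padic_absq eqxx. Qed.

Lemma padic_absq_ge0 x : 0 <= absq x.
Proof. by rewrite /padic_absq; case: eqP => // _; rewrite exprz_ge0 // ltW. Qed.

Lemma padic_absq_eq0 x : (absq x == 0) = (x == 0).
Proof.
rewrite /padic_absq; case: (eqVneq x 0) => [_|_]; first by rewrite eqxx.
by apply/negbTE/expfz_neq0; rewrite gt_eqF.
Qed.

Lemma padic_absqM x y : absq (x * y) = absq x * absq y.
Proof.
rewrite /padic_absq mulf_eq0; case: (eqVneq x 0) => [|x0] /=; first by rewrite mul0r.
case: (eqVneq y 0) => [|y0] /=; first by rewrite mulr0.
rewrite -expfzDr ?gt_eqF //; congr (_ ^ _).
rewrite -{1}(divq_num_den x) -{1}(divq_num_den y) mulf_div -!intrM padic_valq_frac.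
- rewrite !abszM !lognM ?absz_gt0 ?numq_eq0 ?denq_neq0 //.
  by rewrite /padic_valq; lia.
- by rewrite mulf_neq0 ?numq_eq0.
- by rewrite mulf_neq0 ?denq_neq0.
Qed.

Lemma padic_absq1 : absq 1 = 1.
Proof. by rewrite /padic_absq oner_eq0 /padic_valq /= !logn1 subrr oppr0 expr0z. Qed.

Lemma padic_absqV x : absq x^-1 = (absq x)^-1.
Proof.
case: (eqVneq x 0) => [->|x0]; first by rewrite invr0 padic_absq0.
apply: (@mulfI _ (absq x)); first by rewrite padic_absq_eq0.
by rewrite -padic_absqM !divff ?padic_absq1 ?padic_absq_eq0.
Qed.

Lemma padic_absqN x : absq (- x) = absq x.
Proof. by rewrite /padic_absq oppr_eq0 /padic_valq numqN denqN abszN. Qed.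

Lemma logn_add_ge (a b : int) : a + b != 0 -> a != 0 -> b != 0 ->
  (minn (logn p `|a|) (logn p `|b|) <= logn p `|(a + b)%R|)%N.
Proof.
move=> ab0 a0 b0; rewrite -pfactor_dvdn ?absz_gt0 //.
set k := minn _ _.
have: (((p ^ k)%N%:Z %| a) && ((p ^ k)%N%:Z %| b))%Z.
  by rewrite !dvdzE /= !pfactor_dvdn ?absz_gt0 // geq_minl geq_minr.
by case/andP=> /dvdzP[c ->] /dvdzP[d ->]; rewrite -mulrDl abszM dvdn_mull.
Qed.

Lemma padic_absqD x y : absq (x + y) <= Num.max (absq x) (absq y).
Proof.
case: (eqVneq x 0) => [->|x0]; first by rewrite add0r le_max lexx orbT.
case: (eqVneq y 0) => [->|y0]; first by rewrite addr0 le_max lexx.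
case: (eqVneq (x + y) 0) => [->|xy0].
  by rewrite padic_absq0 le_max !padic_absq_ge0.
pose d := denq x * denq y.
have d0 : d != 0 by rewrite mulf_neq0 ?denq_neq0.
have dx : (denq x)%:~R != 0 :> rat by rewrite intr_eq0 denq_neq0.
have dy : (denq y)%:~R != 0 :> rat by rewrite intr_eq0 denq_neq0.
pose a := numq x * denq y; pose b := numq y * denq x.
have Ex : x = a%:Q / d%:Q.
  by rewrite -{1}(divq_num_den x) /a /d !intrM; field; apply/andP.
have Ey : y = b%:Q / d%:Q.
  by rewrite -{1}(divq_num_den y) /b /d !intrM; field; apply/andP.
have a0 : a != 0 by rewrite mulf_neq0 ?numq_eq0 ?denq_neq0.
have b0 : b != 0 by rewrite mulf_neq0 ?numq_eq0 ?denq_neq0.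
have Exy : x + y = (a + b)%:Q / d%:Q by rewrite {1}Ex {1}Ey -mulrDl intrD.
have ab0 : a + b != 0.
  by apply: contra_neq xy0 => ab; rewrite Exy ab mul0r.
rewrite /padic_absq (negbTE x0) (negbTE y0) (negbTE xy0) le_max.
rewrite !ler_eXz2l // Exy Ex Ey !padic_valq_frac //.
have := logn_add_ge ab0 a0 b0; move: (logn p `|a|%N) (logn p `|b|%N) (logn p `|(a + b)%R|%N) (logn p `|d|%N).
move=> i j k l; clear; rewrite !lerN2 !lerD2r !lez_nat geq_min; case/orP=> ->; rewrite ?orbT //.
Qed.

End Absq.

Section Cauchy.
Variables (p : nat) (p_pr : prime p).
Local Notation absq := (padic_absq p).

Definition padic_cauchy (u : nat -> rat) : Prop :=
  forall e : rat, 0 < e -> exists N : nat, forall m n : nat,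
    (N <= m)%N -> (N <= n)%N -> absq (u m - u n) < e.

Definition padic_null (u : nat -> rat) : Prop :=
  forall e : rat, 0 < e -> exists N : nat, forall n : nat,
    (N <= n)%N -> absq (u n) < e.

Definition padic_cauchy_pred (_ : prime p) : {pred nat -> rat} :=
  fun u => `[< padic_cauchy u >].

Lemma padic_absq_lt x y e : absq x < e -> absq y < e -> absq (x + y) < e.
Proof.
by move=> xe ye; apply: le_lt_trans (padic_absqD p_pr x y) _; rewrite gt_max xe.
Qed.

Lemma padic_absqB x y : absq (x - y) = absq (y - x).
Proof. by rewrite -padic_absqN opprB. Qed.

Lemma padic_cauchy_bounded u : padic_cauchy u ->
  exists2 B : rat, 0 < B & exists N : nat, forall n, (N <= n)%N -> absq (u n) < B.
Proof.
move=> /(_ 1 ltr01)[N uN]; exists (absq (u N) + 1).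
  by rewrite ltr_wpDl ?padic_absq_ge0.
exists N => n Nn; rewrite -(subrK (u N) (u n)); apply: padic_absq_lt.
  by rewrite (lt_le_trans (uN _ _ Nn (leqnn _))) // lerDr padic_absq_ge0.
by rewrite ltrDl.
Qed.

Lemma padic_cauchy_subring : subring_closed (padic_cauchy_pred p_pr).
Proof.
split.
- apply/asboolP => e e0; exists 0%N => m n _ _.
  by rewrite subrr padic_absq0.
- move=> u v /asboolP uC /asboolP vC; apply/asboolP => e e0.
  have [N uN] := uC _ e0; have [M vM] := vC _ e0.
  exists (maxn N M) => m n; rewrite !geq_max => /andP[Nm Mm] /andP[Nn Mn].
  have -> : (u - v) m - (u - v) n = (u m - u n) + (v n - v m).
    rewrite (_ : (u - v) m = u m - v m) // (_ : (u - v) n = u n - v n) //; ring.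
  by apply: padic_absq_lt; [exact: uN|exact: vM].
- move=> u v /asboolP uC /asboolP vC; apply/asboolP => e e0.
  have [B B0 [N0 uB]] := padic_cauchy_bounded uC.
  have [C C0 [M0 vB]] := padic_cauchy_bounded vC.
  have [N uN] := uC _ (divr_gt0 e0 C0); have [M vM] := vC _ (divr_gt0 e0 B0).
  exists (maxn (maxn N0 M0) (maxn N M)) => m n.
  rewrite !geq_max => /andP[/andP[N0m M0m] /andP[Nm Mm]].
  move=> /andP[/andP[N0n M0n] /andP[Nn Mn]].
  have -> : (u * v) m - (u * v) n = u m * (v m - v n) + (u m - u n) * v n.
    rewrite (_ : (u * v) m = u m * v m) // (_ : (u * v) n = u n * v n) //; ring.
  apply: padic_absq_lt; rewrite padic_absqM //.
    have -> : e = B * (e / B) by rewrite mulrC divfK // gt_eqF.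
    by apply: ltr_pM; rewrite ?padic_absq_ge0 ?uB ?vM.
  have -> : e = (e / C) * C by rewrite divfK // gt_eqF.
  by apply: ltr_pM; rewrite ?padic_absq_ge0 ?vB ?uN.
Qed.

HB.instance Definition _ :=
  GRing.isSubringClosed.Build _ (padic_cauchy_pred p_pr) padic_cauchy_subring.

Record padic_cauchy_seq := PadicCauchySeq {
  padic_cauchy_val :> nat -> rat;
  padic_cauchy_valP : padic_cauchy_val \in padic_cauchy_pred p_pr }.

HB.instance Definition _ := [isSub for padic_cauchy_val].
HB.instance Definition _ := [Choice of padic_cauchy_seq by <:].
HB.instance Definition _ := [SubChoice_isSubComNzRing of padic_cauchy_seq by <:].

Definition padic_null_pred : {pred padic_cauchy_seq} :=
  fun u => `[< padic_null u >].

Lemma padic_null_idealr : idealr_closed padic_null_pred.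
Proof.
split.
- by apply/asboolP => e e0; exists 0%N => n _; rewrite padic_absq0.
- apply/negP => /asboolP /(_ 1 ltr01)[N /(_ N (leqnn N))].
  by rewrite (_ : padic_cauchy_val 1 N = 1) // padic_absq1 ltxx.
- move=> a u v /asboolP uN /asboolP vN; apply/asboolP => e e0.
  have /asboolP aC := padic_cauchy_valP a.
  have [B B0 [N0 aB]] := padic_cauchy_bounded aC.
  have [N uN'] := uN _ (divr_gt0 e0 B0); have [M vM] := vN _ e0.
  exists (maxn N0 (maxn N M)) => n.
  rewrite !geq_max => /andP[N0n /andP[Nn Mn]].
  rewrite (_ : padic_cauchy_val (a * u + v) n = a n * u n + v n) //.
  apply: padic_absq_lt; last exact: vM.
  rewrite padic_absqM //.
  have -> : e = B * (e / B) by rewrite mulrC divfK // gt_eqF.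
  by apply: ltr_pM; rewrite ?padic_absq_ge0 ?aB ?uN'.
Qed.

HB.instance Definition _ :=
  isIdealr.Build _ padic_null_pred padic_null_idealr.

(* Q_p: Cauchy sequences of rationals for the p-adic absolute value, modulo
   null sequences. *)
Definition padic : Type := {ideal_quot padic_null_pred}.

HB.instance Definition _ := GRing.ComNzRing.on padic.
HB.instance Definition _ := @NzRingQuotient.on padic.

End Cauchy.
Arguments padic_null_pred {p} p_pr.

Section Padic.
Variables (p : nat) (p_pr : prime p).
Local Notation absq := (padic_absq p).
Local Notation Qp := (padic p_pr).
Local Open Scope quotient_scope.
Implicit Types (x y : Qp) (u v : padic_cauchy_seq p_pr).

Lemma padic_pi0 : \pi_Qp 0 = 0. Proof. exact: raddf0. Qed.
Lemma padic_pi1 : \pi_Qp 1 = 1. Proof. exact: rmorph1. Qed.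
Lemma padic_piD u v : \pi_Qp (u + v) = \pi_Qp u + \pi_Qp v.
Proof. exact: raddfD. Qed.
Lemma padic_piN u : \pi_Qp (- u) = - \pi_Qp u.
Proof. exact: raddfN. Qed.
Lemma padic_piM u v : \pi_Qp (u * v) = \pi_Qp u * \pi_Qp v.
Proof. exact: rmorphM. Qed.

Lemma padic_pi_eq0 u : \pi_Qp u = 0 <-> padic_null p u.
Proof.
rewrite -padic_pi0; split=> [/eqP|uN].
  rewrite -[_ == _]/(u == 0 %[mod Qp]) -Quotient.idealrBE subr0.
  by move/asboolP.
apply/eqP; rewrite -[_ == _]/(u == 0 %[mod Qp]) -Quotient.idealrBE subr0.
exact/asboolP.
Qed.

Lemma padic_not_null u : ~ padic_null p u ->
  exists2 c : rat, 0 < c & exists N : nat, forall n, (N <= n)%N -> c <= absq (u n).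
Proof.
move=> unN; have /asboolP uC := padic_cauchy_valP u.
have [c c0 cP] : exists2 c : rat, 0 < c &
    forall N, exists2 n, (N <= n)%N & c <= absq (u n).
  apply: contrapT => nP; apply: unN => e e0.
  apply: contrapT => nQ; apply: nP; exists e => // N.
  apply: contrapT => nR; apply: nQ; exists N => n Nn.
  by rewrite ltNge; apply/negP => le; apply: nR; exists n.
exists c => //; have [N uN] := uC _ c0; exists N => n Nn.
have [m Nm cm] := cP N; rewrite leNgt; apply/negP => unc.
move: cm; rewrite leNgt; apply/negP; rewrite negbK.
by rewrite -(subrK (u n) (u m)); apply: padic_absq_lt => //; exact: uN.
Qed.

Lemma padic_unit_exists x : x != 0 -> exists y, y * x = 1.
Proof.
elim/quotW: x => u /eqP u0.
have [c c0 [N uc]] : exists2 c : rat, 0 < c &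
    exists N : nat, forall n, (N <= n)%N -> c <= absq (u n).
  by apply: padic_not_null => uN; apply: u0; apply/padic_pi_eq0.
have une n : (N <= n)%N -> u n != 0.
  by move=> Nn; rewrite -(padic_absq_eq0 p_pr) gt_eqF // (lt_le_trans c0) ?uc.
have /asboolP uC := padic_cauchy_valP u.
have vC : (fun n => (u n)^-1) \in padic_cauchy_pred p_pr.
  apply/asboolP => e e0.
  have [M uM] := uC _ (mulr_gt0 e0 (mulr_gt0 c0 c0)).
  exists (maxn N M) => m n; rewrite !geq_max => /andP[Nm Mm] /andP[Nn Mn].
  have -> : (u m)^-1 - (u n)^-1 = (u n - u m) / (u m * u n).
    by field; rewrite !une.
  rewrite padic_absqM // padic_absqV // padic_absqM //.
  have am := uc _ Nm; have an := uc _ Nn.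
  rewrite ltr_pdivrMr; last by rewrite mulr_gt0 // (lt_le_trans c0).
  apply: (lt_le_trans (uM _ _ Mn Mm)); rewrite ler_pM2l //.
  by apply: ler_pM; rewrite // ltW.
exists (\pi_Qp (PadicCauchySeq vC)).
rewrite -padic_piM -padic_pi1; apply/eqP; rewrite -subr_eq0; apply/eqP.
rewrite -padic_piN -padic_piD; apply/padic_pi_eq0 => e e0.
exists N => n Nn.
rewrite (_ : padic_cauchy_val _ n = (u n)^-1 * u n - 1) //.
by rewrite mulVf ?une // subrr padic_absq0.
Qed.

Definition padic_inv (x : Qp) : Qp := xget 0 [set y | y * x = 1]%classic.

Lemma padic_mulVf x : x != 0 -> padic_inv x * x = 1.
Proof. by move=> /padic_unit_exists ex; apply: (xgetPex 0 ex). Qed.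

Lemma padic_inv0 : padic_inv 0 = 0.
Proof.
apply: xgetPN => y /=; rewrite mulr0 => /esym/eqP.
by rewrite oner_eq0.
Qed.

HB.instance Definition _ :=
  GRing.ComNzRing_isField.Build Qp padic_mulVf padic_inv0.

Definition padic_abs_lim (u : nat -> rat) (r : rat) : Prop :=
  forall e : rat, 0 < e -> exists N : nat, forall n : nat,
    (N <= n)%N -> `|absq (u n) - r| < e.

Definition padic_abs (x : Qp) : rat :=
  xget 0 [set r | padic_abs_lim (repr x) r]%classic.

Lemma padic_absq_eq a b : absq (a - b) < absq b -> absq a = absq b.
Proof.
move=> ab; apply/eqP; rewrite eq_le; apply/andP; split.
  rewrite -{1}(subrK b a) (le_trans (padic_absqD p_pr _ _)) //.
  by rewrite ge_max lexx ltW.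
have: absq b <= Num.max (absq (b - a)) (absq a).
  by rewrite -{1}(subrK a b) padic_absqD.
by rewrite padic_absqB // le_max leNgt ab.
Qed.

Lemma padic_abs_lim_uniq u r s :
  padic_abs_lim u r -> padic_abs_lim u s -> r = s.
Proof.
move=> ur us; apply/eqP; rewrite -subr_eq0 -normr_eq0.
rewrite eq_le normr_ge0 andbT leNgt; apply/negP => rs.
have e0 : 0 < `|r - s| / 2 by rewrite divr_gt0.
have [N uN] := ur _ e0; have [M uM] := us _ e0.
have h1 := uN _ (leq_maxl N M); have h2 := uM _ (leq_maxr N M).
have : `|r - s| <= `|absq (u (maxn N M)) - r| + `|absq (u (maxn N M)) - s|.
  by rewrite [X in _ <= X + _]distrC; apply: ler_distD.
lra.
Qed.

Lemma padic_abs_lim_exists u : exists r, padic_abs_lim u r.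
Proof.
have /asboolP uC := padic_cauchy_valP u.
have [uN|/padic_not_null[c c0 [N cN]]] := pselect (padic_null p u).
  exists 0 => e e0; have [N uN'] := uN _ e0; exists N => n Nn.
  by rewrite subr0 ger0_norm ?padic_absq_ge0 ?uN'.
have [M uM] := uC _ c0; exists (absq (u (maxn N M))) => e e0.
exists (maxn N M) => n; rewrite geq_max => /andP[Nn Mn].
rewrite (@padic_absq_eq (u n) (u (maxn N M))) ?subrr ?normr0 //.
by apply: lt_le_trans (uM _ _ Mn (leq_maxr _ _)) (cN _ (leq_maxl _ _)).
Qed.

Lemma padic_abs_lim_eqv u v r :
  \pi_Qp u = \pi_Qp v -> padic_abs_lim u r -> padic_abs_lim v r.
Proof.
move=> /eqP; rewrite -subr_eq0 -padic_piN -padic_piD => /eqP/padic_pi_eq0 uvN.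
have uvE n : padic_cauchy_val (u - v) n = u n - v n by [].
have [r' vr'] := padic_abs_lim_exists v.
move=> ur; suff -> : r = r' by [].
have [vN|/padic_not_null[c c0 [N cN]]] := pselect (padic_null p v).
  have -> : r' = 0.
    apply: padic_abs_lim_uniq vr' _ => e e0; have [N vN'] := vN _ e0.
    by exists N => n Nn; rewrite subr0 ger0_norm ?padic_absq_ge0 ?vN'.
  apply: padic_abs_lim_uniq ur _ => e e0.
  have [N vN'] := vN _ e0; have [M uM] := uvN _ e0.
  exists (maxn N M) => n; rewrite geq_max => /andP[Nn Mn].
  rewrite subr0 ger0_norm ?padic_absq_ge0 // -(subrK (v n) (u n)).
  by apply: padic_absq_lt; rewrite -?uvE ?uM ?vN'.
apply: padic_abs_lim_uniq ur _ => e e0.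
have [M uM] := uvN _ c0; have [L vL] := vr' _ e0.
exists (maxn L (maxn N M)) => n; rewrite !geq_max => /andP[Ln /andP[Nn Mn]].
rewrite (@padic_absq_eq (u n) (v n)) ?vL // -uvE.
exact: lt_le_trans (uM _ Mn) (cN _ Nn).
Qed.

Lemma padic_abs_pi u : padic_abs_lim u (padic_abs (\pi_Qp u)).
Proof.
apply: (@padic_abs_lim_eqv (repr (\pi_Qp u))); first by rewrite reprK.
exact: (xgetPex 0 (padic_abs_lim_exists _)).
Qed.

Lemma padic_absE u r : padic_abs_lim u r -> padic_abs (\pi_Qp u) = r.
Proof. exact: padic_abs_lim_uniq (padic_abs_pi u). Qed.

Lemma padic_abs_ge0 x : 0 <= padic_abs x.
Proof.
elim/quotW: x => u; rewrite leNgt; apply/negP => lt0.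
have := padic_abs_pi u; set r := padic_abs _ in lt0 * => /(_ (- r)).
rewrite oppr_gt0 => /(_ lt0)[N /(_ _ (leqnn N))].
rewrite ger0_norm ?subr_ge0; last by rewrite (le_trans (ltW lt0)) ?padic_absq_ge0.
have := padic_absq_ge0 p (u N); lra.
Qed.

Lemma padic_abs_lt u (e : rat) : 0 < e ->
  (exists N : nat, forall n, (N <= n)%N -> absq (u n) < e) ->
  padic_abs (\pi_Qp u) <= e.
Proof.
move=> e0 [N uN]; rewrite leNgt; apply/negP => er.
have := padic_abs_pi u; set r := padic_abs _ in er * => /(_ (r - e)).
rewrite subr_gt0 => /(_ er)[M uM].
have := uM _ (leq_maxr N M); have := uN _ (leq_maxl N M).
rewrite ltr_norml => h /andP[h1 _]; lra.
Qed.

Lemma padic_abs_eq0 x : (padic_abs x == 0) = (x == 0).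
Proof.
elim/quotW: x => u; apply/eqP/eqP => [u0|/padic_pi_eq0 uN].
  apply/padic_pi_eq0 => e e0; have := padic_abs_pi u.
  rewrite u0 => /(_ e e0)[N uN]; exists N => n /uN.
  by rewrite subr0 ger0_norm ?padic_absq_ge0.
apply: padic_absE => e e0; have [N uN'] := uN _ e0; exists N => n /uN'.
by rewrite subr0 ger0_norm ?padic_absq_ge0.
Qed.

Lemma padic_abs0 : padic_abs 0 = 0.
Proof. by apply/eqP; rewrite padic_abs_eq0. Qed.

Lemma padic_absN x : padic_abs (- x) = padic_abs x.
Proof.
elim/quotW: x => u; rewrite -padic_piN; apply: padic_absE => e e0.
have [N uN] := padic_abs_pi u e0; exists N => n /uN.
by rewrite (_ : padic_cauchy_val (- u) n = - u n) // padic_absqN.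
Qed.

Lemma padic_abs_eventually u : ~ padic_null p u ->
  exists N : nat, forall n, (N <= n)%N -> padic_abs (\pi_Qp u) = absq (u n).
Proof.
move=> /padic_not_null[c c0 [N cN]]; have /asboolP uC := padic_cauchy_valP u.
have [M uM] := uC _ c0; exists (maxn N M) => n.
rewrite geq_max => /andP[Nn Mn]; apply: padic_absE => e e0.
exists (maxn N M) => m; rewrite geq_max => /andP[Nm Mm].
rewrite (@padic_absq_eq (u m) (u n)) ?subrr ?normr0 //.
exact: lt_le_trans (uM _ _ Mm Mn) (cN _ Nn).
Qed.

Lemma padic_absM x y : padic_abs (x * y) = padic_abs x * padic_abs y.
Proof.
have [->|x0] := eqVneq x 0; first by rewrite !(mul0r, padic_abs0).
have [->|y0] := eqVneq y 0; first by rewrite !(mulr0, padic_abs0).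
have xy0 : x * y != 0 by rewrite mulf_neq0.
elim/quotW: x x0 xy0 => u; elim/quotW: y y0 => v.
rewrite -padic_piM => /eqP v0 /eqP u0 /eqP uv0.
have [|N uN] := @padic_abs_eventually u; first by move/padic_pi_eq0.
have [|M vM] := @padic_abs_eventually v; first by move/padic_pi_eq0.
have [|L uvL] := @padic_abs_eventually (u * v); first by move/padic_pi_eq0.
pose n := maxn N (maxn M L).
rewrite (uvL n) ?(uN n) ?(vM n) ?leq_max ?leqnn ?orbT //.
exact: padic_absqM.
Qed.

Lemma padic_absD x y : padic_abs (x + y) <= Num.max (padic_abs x) (padic_abs y).
Proof.
have [->|x0] := eqVneq x 0; first by rewrite add0r le_max lexx orbT.
have [->|y0] := eqVneq y 0; first by rewrite addr0 le_max lexx.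
have [->|xy0] := eqVneq (x + y) 0.
  by rewrite padic_abs0 le_max padic_abs_ge0.
elim/quotW: x x0 xy0 => u; elim/quotW: y y0 => v.
rewrite -padic_piD => /eqP v0 /eqP u0 /eqP uv0.
have [|N uN] := @padic_abs_eventually u; first by move/padic_pi_eq0.
have [|M vM] := @padic_abs_eventually v; first by move/padic_pi_eq0.
have [|L uvL] := @padic_abs_eventually (u + v); first by move/padic_pi_eq0.
pose n := maxn N (maxn M L).
rewrite (uvL n) ?(uN n) ?(vM n) ?leq_max ?leqnn ?orbT //.
exact: padic_absqD.
Qed.

Lemma padic_const_subproof (q : rat) :
  (fun=> q) \in padic_cauchy_pred p_pr.
Proof.
by apply/asboolP => e e0; exists 0%N => m n _ _; rewrite subrr padic_absq0.
Qed.

Definition padic_const q := PadicCauchySeq (padic_const_subproof q).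

Definition padic_of_rat (q : rat) : Qp := \pi_Qp (padic_const q).

Lemma padic_of_rat_is_zmod_morphism : zmod_morphism padic_of_rat.
Proof.
by move=> a b; rewrite -padic_piN -padic_piD; congr (\pi_Qp _); apply: val_inj.
Qed.

Lemma padic_of_rat_is_monoid_morphism : monoid_morphism padic_of_rat.
Proof.
split; first by rewrite -padic_pi1; congr (\pi_Qp _); apply: val_inj.
by move=> a b; rewrite -padic_piM; congr (\pi_Qp _); apply: val_inj.
Qed.

HB.instance Definition _ := GRing.isZmodMorphism.Build rat Qp
  padic_of_rat padic_of_rat_is_zmod_morphism.
HB.instance Definition _ := GRing.isMonoidMorphism.Build rat Qp
  padic_of_rat padic_of_rat_is_monoid_morphism.

Lemma padic_ratrE (q : rat) : ratr q = padic_of_rat q.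
Proof. exact/esym/fmorph_eq_rat. Qed.

Lemma padic_abs_ratr (q : rat) : padic_abs (ratr q) = absq q.
Proof.
rewrite padic_ratrE /padic_of_rat; apply: padic_absE => e e0.
by exists 0%N => n _; rewrite subrr normr0.
Qed.

Lemma padic_ratr_dense x (e : rat) : 0 < e ->
  exists q : rat, padic_abs (x - ratr q) < e.
Proof.
elim/quotW: x => u e0; have /asboolP uC := padic_cauchy_valP u.
have e20 : 0 < e / 2 by rewrite divr_gt0.
have [N uN] := uC _ e20; exists (u N).
apply: (@le_lt_trans _ _ (e / 2)); last by lra.
rewrite padic_ratrE /padic_of_rat -padic_piN -padic_piD; apply: padic_abs_lt => //.
by exists N => n Nn; exact: uN Nn (leqnn N).
Qed.

Local Open Scope classical_set_scope.

Definition padic_ball (x : Qp) (e : rat) : set Qp :=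
  [set y | padic_abs (x - y) < e].

HB.instance Definition _ := hasNbhs.Build Qp (nbhs_ (entourage_ padic_ball)).

Lemma padic_ball_center x (e : rat) : 0 < e -> padic_ball x e x.
Proof. by rewrite /padic_ball /= subrr padic_abs0. Qed.

Lemma padic_ball_sym x y (e : rat) : padic_ball x e y -> padic_ball y e x.
Proof. by rewrite /padic_ball /= -padic_absN opprB. Qed.

Lemma padic_ball_triangle x y z (e1 e2 : rat) :
  padic_ball x e1 y -> padic_ball y e2 z -> padic_ball x (e1 + e2) z.
Proof.
rewrite /padic_ball /= => xy yz.
have -> : x - z = (x - y) + (y - z) by rewrite addrA subrK.
apply: le_lt_trans (padic_absD _ _) _.
have := padic_abs_ge0 (x - y); have := padic_abs_ge0 (y - z).
by rewrite gt_max; lra.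
Qed.

HB.instance Definition _ := Nbhs_isPseudoMetric.Build rat Qp erefl
  padic_ball_center padic_ball_sym padic_ball_triangle erefl.

(* With [padic_abs_ratr] and [padic_ratr_dense]: [padic p_pr] is the completion
   of [rat] for the p-adic absolute value. *)
Lemma padic_complete (x : nat -> Qp) :
  (forall e : rat, 0 < e -> exists N : nat, forall m n : nat,
    (N <= m)%N -> (N <= n)%N -> padic_abs (x m - x n) < e) ->
  exists l : Qp, x @ \oo --> l.
Proof.
move=> xC.
pose q n : rat := xget 0 [set r | padic_abs (x n - ratr r) < n.+1%:R^-1].
have qP n : padic_abs (x n - ratr (q n)) < n.+1%:R^-1.
  have n0 : 0 < n.+1%:R^-1 :> rat by rewrite invr_gt0.
  exact: (xgetPex 0 (padic_ratr_dense (x n) n0)).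
have qP' (e : rat) : 0 < e -> exists N : nat, forall n, (N <= n)%N ->
    padic_abs (x n - ratr (q n)) < e.
  move=> e0; exists (Num.bound e^-1) => n Nn; apply: lt_trans (qP n) _.
  rewrite invf_plt ?posrE //; apply: (lt_le_trans (archi_boundP _)).
    by rewrite invr_ge0 ltW.
  by rewrite ler_nat (leq_trans Nn).
have absB y z : padic_abs (y - z) = padic_abs (z - y).
  by rewrite -padic_absN opprB.
have absD y z (e : rat) : padic_abs y < e -> padic_abs z < e ->
    padic_abs (y + z) < e.
  by move=> ye ze; apply: le_lt_trans (padic_absD y z) _; rewrite gt_max ye.
have qC : q \in padic_cauchy_pred p_pr.
  apply/asboolP => e e0; have [N xN] := xC _ e0; have [M qM] := qP' _ e0.
  exists (maxn N M) => m n; rewrite !geq_max => /andP[Nm Mm] /andP[Nn Mn].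
  rewrite -(padic_abs_ratr) !padic_ratrE rmorphB /= -!padic_ratrE.
  rewrite (_ : ratr (q m) - ratr (q n) =
    (ratr (q m) - x m) + ((x m - x n) + (x n - ratr (q n)))); last first.
    by rewrite !addrA !subrK.
  by apply: (absD _ _ _); [rewrite absB qM|apply: (absD _ _ _); [exact: xN|exact: qM]].
exists (\pi_Qp (PadicCauchySeq qC)); apply/cvg_ballP => e e0.
have e20 : 0 < e / 2 by rewrite divr_gt0.
have [M qM] := qP' _ e0; have /asboolP qC' := qC; have [N qN] := qC' _ e20.
exists (maxn N M) => // n /=; rewrite geq_max => /andP[Nn Mn].
rewrite /ball /= /padic_ball /=.
rewrite -(subrK (ratr (q n)) (\pi_Qp _)) -addrA; apply: (absD _ _ _); last first.
  by rewrite absB qM.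
apply: (@le_lt_trans _ _ (e / 2)); last by lra.
rewrite padic_ratrE /padic_of_rat -padic_piN -padic_piD.
by apply: padic_abs_lt => //; exists N => m Nm; exact: qN Nm Nn.
Qed.

End Padic.

Section Digits.
Variables (p : nat) (p_pr : prime p).
Local Notation Qp := (padic p_pr).
Local Open Scope classical_set_scope.

(* [padic_abs u < p ^ - n] means n < v_p(u), with v_p(0) = +oo. The partial sums
   run over all exponents -N <= n < N. *)
Definition padic_expansion (u : Qp) (c : int -> nat) : Prop :=
  [/\ forall n, (c n < p)%N,
      forall n, padic_abs u < p%:R ^ (- n) -> c n = 0%N &
      (fun N : nat => \sum_(i < N.*2)
         (c (i%:Z - N%:Z))%:R * (p%:R : Qp) ^ (i%:Z - N%:Z)) @ \oo --> u].

Definition padic_digit (u : Qp) : int -> nat :=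
  xget (fun=> 0%N) [set c | padic_expansion u c].

Definition padic_floor (u : Qp) : rat :=
  \sum_(n \in [set n : int | n <= 0]) ((padic_digit u n)%:R * p%:R ^ n : rat).

End Digits.

Section Algorithm.
Variables (p : nat) (p_pr : prime p) (R : realType) (K : fieldType).
Variables (sigma_inf : {rmorphism K -> R}) (sigma_p : {rmorphism K -> padic p_pr}).

Definition least_minimizer (f : int -> R) : int :=
  xget 0 [set m | (forall i, f m <= f i) /\
                  (forall i, (forall j, f i <= f j) -> m <= i)]%classic.

Definition cf_b0 (a : K) : rat :=
  let s := padic_floor (sigma_p a) in
  let m := least_minimizer
    (fun i => `|sigma_inf a - i%:~R * p%:R - ratr s|) in
  m%:~R * p%:R + s.

Definition cf_b1 (a : K) : rat :=
  let s := padic_floor (sigma_p a) in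
  let m := least_minimizer (fun i => `|sigma_inf a - i%:~R - ratr s|) in
  m%:~R + s.

Definition cf_b (eps : bool) : K -> rat := if eps then cf_b1 else cf_b0.

Definition cf_F (eps : bool) (a : K) : option K :=
  if a == ratr (cf_b eps a) then None else Some (a - ratr (cf_b eps a))^-1.

(* [None] once the algorithm has halted *)
Fixpoint cf_alpha (alpha : K) (n : nat) : option K :=
  if n is n'.+1 then obind (cf_F (odd n')) (cf_alpha alpha n') else Some alpha.

Definition cf_partial (alpha : K) (n : nat) : option rat :=
  omap (cf_b (odd n)) (cf_alpha alpha n).

Definition cf_step (b : rat) : 'M[rat]_2 :=
  \matrix_(i, j) if i != j then 1 else if i == 0 then b else 0.

(* Meaningful only as long as the [n]-th partial quotient is defined. *)
Definition cf_matrix (alpha : K) (n : nat) : 'M[rat]_2 :=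
  \prod_(i < n.+1) cf_step (odflt 0 (cf_partial alpha i)).

Definition cf_num (alpha : K) (n : nat) : rat := cf_matrix alpha n 0 0.
Definition cf_den (alpha : K) (n : nat) : rat := cf_matrix alpha n 1 0.

End Algorithm.

(* Main.v *)
(* The convergence is purely p-adic: the real embedding only selects an integer
   multiple of p (n even) or an integer (n odd). Since a p-adic number differs
   from its floor by at most 1/p, the n-th partial quotient b_n is within 1/p
   (n even) or 1 (n odd) of alpha_n, so |b_n| = |alpha_n| >= 1 for even n > 0
   and >= p for odd n. By the ultrametric inequality |q_n| = |b_n| |q_(n-1)|,
   hence |q_n| >= p^ceil(n/2). The errors e_n = alpha q_n - p_n satisfy
   e_n = (b_n - alpha_n) e_(n-1), so |e_n| <= 1 and
   |alpha - p_n/q_n| = |e_n| / |q_n| tends to 0. If the algorithm halts at n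
   then alpha_n = b_n and e_n = 0. *)
Require Import Defs.
From HB Require Import structures.
From mathcomp Require Import all_boot all_order all_algebra.
From mathcomp Require Import all_classical all_reals topology.
From mathcomp Require Import ring zify.
Import Order.TTheory GRing.Theory Num.Theory.
Local Open Scope ring_scope.
Local Open Scope classical_set_scope.

(** * Absolute values in Q_p and extraction of single digits *)

Section PadicDigits.
Variables (p : nat) (p_pr : prime p).
Local Notation Qp := (padic p_pr).
Local Notation pR := (p%:R : rat).
Implicit Types (x y : Qp) (q : rat).

Lemma prime_ratr_gt1 : 1 < pR. Proof. by rewrite ltr1n prime_gt1. Qed.

Lemma prime_ratr_gt0 : 0 < pR. Proof. by rewrite ltr0n prime_gt0. Qed.

Lemma padic_absq_int (z : int) : padic_absq p z%:~R <= 1.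
Proof.
rewrite /padic_absq; case: ifP => // _.
rewrite /padic_valq numq_int denq_int logn1 subr0 -(expr0z pR).
by rewrite ler_eXz2l ?prime_ratr_gt1 // oppr_le0.
Qed.

Lemma padic_absq_prime : padic_absq p pR = pR^-1.
Proof.
rewrite /padic_absq gt_eqF ?prime_ratr_gt0 // /padic_valq (_ : pR = p%:Z%:~R) // numq_int denq_int.
by rewrite logn1 subr0 /= logn_prime // eqxx.
Qed.

Lemma padic_absq_eq1 (z : int) : ~~ (p %| `|z|)%N -> padic_absq p z%:~R = 1.
Proof.
move=> pz; rewrite /padic_absq intr_eq0; case: eqP pz => [->|_ pz]; first by rewrite dvdn0.
by rewrite /padic_valq numq_int denq_int logn1 subr0 lognE (negPf pz) !andbF.
Qed.

(** In lowest terms the denominator of [q] is prime to p, hence invertible modulo p; the digit is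
    the numerator times that inverse, reduced modulo p. *)
Lemma padic_absq_digit q : padic_absq p q <= 1 ->
  exists2 d : nat, (d < p)%N & padic_absq p (q - d%:R) <= pR^-1.
Proof.
move=> q1; have pden : ~~ (p %| `|denq q|)%N.
  apply/negP => pd; have: ~~ (p %| `|numq q|)%N.
    apply/negP => pn; have := coprime_num_den q; rewrite /coprime => /eqP g1.
    have: (p %| 1)%N by rewrite -g1 dvdn_gcd pn pd.
    by rewrite dvdn1 => /eqP p1; move: (prime_gt1 p_pr); rewrite p1.
  move=> pn; have q0 : q != 0 by rewrite -numq_eq0; apply: contraNneq pn => ->.
  move: q1; rewrite /padic_absq (negPf q0) -(expr0z pR) ler_eXz2l ?prime_ratr_gt1 //.
  rewrite /padic_valq (lognE p `|numq q|) (negPf pn) !andbF.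
  suff: (0 < logn p `|denq q|)%N by lia.
  by rewrite logn_gt0 mem_primes p_pr pd absz_gt0 denq_neq0.
(* The Bezout coefficient [a] is the inverse of [denq q] modulo p. *)
have [a [b ab]] := Bezoutz (denq q) p%:Z.
have g1 : gcdz (denq q) p%:Z = 1.
  by rewrite /gcdz /= gcdnC; congr Posz; apply/eqP; rewrite -/(coprime _ _) prime_coprime.
rewrite g1 in ab.
have p0 : (p%:Z != 0)%R by rewrite eqz_nat -lt0n prime_gt0.
pose d := `|(numq q * a %% p%:Z)%Z|%N.
have dE : d%:Z = (numq q * a %% p%:Z)%Z by rewrite /d gez0_abs ?modz_ge0.
exists d; first by rewrite -ltz_nat dE ltz_pmod // ltz_nat prime_gt0.
have dena : (denq q)%:~R != 0 :> rat by rewrite intr_eq0 denq_neq0.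
pose k := numq q * b + (numq q * a %/ p%:Z)%Z * denq q.
have kE : numq q - d%:Z * denq q = p%:Z * k.
  have := divz_eq (numq q * a) p%:Z; rewrite -dE /k.
  move: (numq q * a %/ p%:Z)%Z => e E.
  have -> : d%:Z = numq q * a - e * p%:Z by rewrite E; ring.
  by rewrite -[X in X - _]mulr1 -ab; ring.
have -> : q - d%:R = pR * k%:~R / (denq q)%:~R.
  rewrite (_ : pR = p%:Z%:~R) // -intrM -kE intrB intrM mulrBl mulfK //.
  by rewrite divq_num_den.
rewrite !padic_absqM // padic_absqV // (padic_absq_eq1 _ pden) invr1 mulr1 padic_absq_prime.
by rewrite ler_piMr ?padic_absq_int // invr_ge0 ltW ?prime_ratr_gt0.
Qed.

Lemma padic_abs_nat (n : nat) : padic_abs (n%:R : Qp) = padic_absq p n%:R.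
Proof. by rewrite -padic_abs_ratr padic_ratrE rmorph_nat. Qed.

Lemma padic_abs_prime : padic_abs (p%:R : Qp) = pR^-1.
Proof. by rewrite padic_abs_nat padic_absq_prime. Qed.

Lemma padic_prime_neq0 : (p%:R : Qp) != 0.
Proof. by rewrite -padic_abs_eq0 padic_abs_prime invr_eq0 gt_eqF ?prime_ratr_gt0. Qed.

Lemma padic_abs1 : padic_abs (1 : Qp) = 1.
Proof. by rewrite (padic_abs_nat 1) padic_absq1. Qed.

Lemma padic_absV x : padic_abs x^-1 = (padic_abs x)^-1.
Proof.
have [->|x0] := eqVneq x 0; first by rewrite invr0 padic_abs0 invr0.
apply: (@mulfI _ (padic_abs x)); first by rewrite padic_abs_eq0.
by rewrite -padic_absM !divff ?padic_abs_eq0 // padic_abs1.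
Qed.

Lemma padic_absX x (n : nat) : padic_abs (x ^+ n) = padic_abs x ^+ n.
Proof. by elim: n => [|n IHn]; rewrite ?expr0 ?padic_abs1 // !exprS padic_absM IHn. Qed.

Lemma padic_absXz x (n : int) : padic_abs (x ^ n) = padic_abs x ^ n.
Proof. by case: n => n; rewrite ?NegzE -?exprnN ?padic_absV -?exprnP padic_absX // . Qed.

Lemma padic_abs_subC x y : padic_abs (x - y) = padic_abs (y - x).
Proof. by rewrite -padic_absN opprB. Qed.

Lemma padic_absD_le x y (r : rat) :
  padic_abs x <= r -> padic_abs y <= r -> padic_abs (x + y) <= r.
Proof. by move=> xr yr; apply: le_trans (padic_absD x y) _; rewrite ge_max xr. Qed.

Lemma padic_abs_sum_le (I : Type) (s : seq I) (P : pred I) (F : I -> Qp) (r : rat) :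
  0 <= r -> (forall i, P i -> padic_abs (F i) <= r) ->
  padic_abs (\sum_(i <- s | P i) F i) <= r.
Proof.
move=> r0 Fr; elim/big_ind: _ => //; first by rewrite padic_abs0.
by move=> x y xr yr; apply: padic_absD_le.
Qed.

(** The isosceles principle: if [y] were smaller than [x], then both [x - y] and [y] would be
    smaller than their sum [x]. *)
Lemma padic_abs_eq_of_lt x y : padic_abs (x - y) < padic_abs x -> padic_abs y = padic_abs x.
Proof.
move=> xy; apply/eqP; rewrite eq_le; apply/andP; split.
  by rewrite -{1}(subrK x y); apply: padic_absD_le; rewrite // padic_abs_subC ltW.
rewrite leNgt; apply/negP => yx.
have := padic_absD (x - y) y; rewrite subrK le_max !leNgt xy /=.
by rewrite yx.
Qed.

(** The absolute value equals that of all late terms of a rational Cauchy sequence representing [x],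
    so it lies in the value group of the rationals. *)
Lemma padic_abs_pow x : x != 0 -> exists n : int, padic_abs x = pR ^ n.
Proof.
elim/quotW: x => u /eqP u0.
have [|N uN] := @padic_abs_eventually _ _ u; first by move/padic_pi_eq0.
move/eqP: u0; rewrite -padic_abs_eq0 (uN N) // /padic_absq.
by case: ifP => [_|_ _]; [rewrite eqxx|exists (- padic_valq p (u N))].
Qed.

Lemma padic_digit_exists x : padic_abs x <= 1 ->
  exists2 d : nat, (d < p)%N & padic_abs (x - d%:R) <= pR^-1.
Proof.
(* A rational within 1/p of [x] is still integral at p, and its digit serves for [x] too. *)
move=> x1; have [q xq] := @padic_ratr_dense _ _ x pR^-1 (ltac:(by rewrite invr_gt0 prime_ratr_gt0)).
have [|d dp qd] := @padic_absq_digit q.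
  rewrite -(padic_abs_ratr p_pr) -(subKr x (ratr q)).
  apply: padic_absD_le; rewrite // padic_absN (le_trans (ltW xq)) //.
  by rewrite invf_le1 ?prime_ratr_gt0 // ltW ?prime_ratr_gt1.
exists d => //; rewrite -(subrK (ratr q) x) -addrA; apply: padic_absD_le; first exact: ltW.
by rewrite padic_ratrE -(rmorph_nat (padic_of_rat p_pr)) -rmorphB /= -padic_ratrE padic_abs_ratr.
Qed.

Definition padic_lead x : nat :=
  xget 0%N [set d : nat | (d < p)%N /\ padic_abs (x - d%:R) <= pR^-1].

(** The shift on p-adic integers: iterating it reads off the successive digits. *)
Definition padic_rem x : Qp := (x - (padic_lead x)%:R) / p%:R.

Lemma padic_lead_spec x : padic_abs x <= 1 ->
  (padic_lead x < p)%N /\ padic_abs (x - (padic_lead x)%:R) <= pR^-1.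
Proof.
move=> /padic_digit_exists[d dp xd].
pose P : set nat := [set d : nat | (d < p)%N /\ padic_abs (x - d%:R) <= pR^-1].
have /(xgetPex 0%N) : exists d, P d by exists d.
by [].
Qed.

Lemma padic_rem_le1 x : padic_abs x <= 1 -> padic_abs (padic_rem x) <= 1.
Proof.
move=> /padic_lead_spec[_ xd]; rewrite padic_absM padic_absV padic_abs_prime invrK.
by rewrite -ler_pdivlMr ?prime_ratr_gt0 // mul1r.
Qed.

Lemma padic_iter_rem_le1 x n : padic_abs x <= 1 -> padic_abs (iter n padic_rem x) <= 1.
Proof. by move=> x1; elim: n => //= n; exact: padic_rem_le1. Qed.

(** Iterates [x = padic_lead x + p * padic_rem x]. The remainder is kept exact, so that the
    truncation error can be read off from it. *)
Lemma padic_sum_lead x n :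
  x = \sum_(i < n) (padic_lead (iter i padic_rem x))%:R * p%:R ^+ i
      + p%:R ^+ n * iter n padic_rem x.
Proof.
elim: n => [|n IHn]; first by rewrite big_ord0 add0r expr0 mul1r.
rewrite big_ord_recr /= [LHS]IHn -addrA; congr (_ + _).
rewrite exprSr -mulrA [p%:R * _]mulrC divfK ?padic_prime_neq0 //.
by rewrite mulrBr [_%:R * _]mulrC addrC subrK.
Qed.

End PadicDigits.

(** * Expansions in powers of p and the p-adic floor *)

Section PadicFloor.
Variables (p : nat) (p_pr : prime p).
Local Notation Qp := (padic p_pr).
Local Notation pR := (p%:R : rat).
Implicit Types (u : Qp) (c : int -> nat).

Lemma prime_expV_small (e : rat) : 0 < e ->
  exists N : nat, forall n, (N <= n)%N -> pR^-1 ^+ n < e.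
Proof.
move=> e0; exists (Num.bound e^-1) => n Nn.
rewrite exprVn invf_plt ?posrE ?exprn_gt0 ?prime_ratr_gt0 //.
apply: lt_le_trans (archi_boundP _) _; first by rewrite invr_ge0 ltW.
by rewrite -natrX ler_nat (leq_trans Nn) // ltnW // ltn_expl // prime_gt1.
Qed.

Lemma padic_abs_expz (n : int) : padic_abs ((p%:R : Qp) ^ n) = pR ^ (- n).
Proof. by rewrite padic_absXz padic_abs_prime exprz_inv. Qed.

(** A nonzero [u] is scaled by a power of p to absolute value 1; the digits of the scaled number,
    shifted back, are those of [u]. *)
Lemma padic_expansion_exists u : exists c, padic_expansion u c.
Proof.
have pR1 := prime_ratr_gt1 _ p_pr; have pR0 := prime_ratr_gt0 _ p_pr.
have p0 := padic_prime_neq0 _ p_pr.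
have [->|u0] := eqVneq u 0.
  exists (fun=> 0%N); split=> // [_|]; first exact: prime_gt0.
  rewrite (_ : (fun _ => _) = fun=> 0); first exact: cvg_cst.
  by apply/funext => N; rewrite big1 // => i _; rewrite mul0r.
have [M uM] := padic_abs_pow _ _ _ u0.
pose x := u * p%:R ^ M.
have x1 : padic_abs x <= 1.
  by rewrite padic_absM padic_abs_expz uM -expfzDr ?gt_eqF // subrr.
pose y k := iter k (padic_rem _ p_pr) x.
have y1 k : padic_abs (y k) <= 1 by exact: padic_iter_rem_le1.
(* Since |u| = p^M, the expansion starts at exponent -M; the default 0 covers the exponents below
   it. *)
pose c (n : int) : nat := if n + M is Posz k then padic_lead _ _ (y k) else 0%N.
exists c; split.
- move=> n; rewrite /c; case: (n + M) => k; last exact: prime_gt0.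
  by have [] := padic_lead_spec _ _ _ (y1 k).
- move=> n; rewrite uM ltr_eXz2l // /c => Mn.
  by case E : (n + M) => [k|//]; move: E Mn; lia.
apply/cvg_ballP => e e0; have [N0 N0e] := prime_expV_small _ e0.
exists (maxn N0 (absz M)) => // N /=; rewrite geq_max => /andP[/N0e Ne MN].
rewrite /ball /= /padic_ball /=; apply: le_lt_trans Ne.
pose F (i : nat) : Qp := (c (i%:Z - N%:Z))%:R * p%:R ^ (i%:Z - N%:Z).
(* Index [i] stands for exponent i - N: the first [k0] terms lie below -M and vanish, the other [L]
   carry the first [L] digits of [x]. Both counts are nonnegative because N >= |M|. *)
pose k0 := absz (N%:Z - M); pose L := absz (N%:Z + M).
have k0E : k0%:Z = N%:Z - M by rewrite /k0; lia.
have LE : L%:Z = N%:Z + M by rewrite /L; lia.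
have -> : \sum_(i < N.*2) F i =
    p%:R ^ (- M) * \sum_(i < L) (padic_lead _ _ (y i))%:R * p%:R ^+ i.
  rewrite -(big_mkord xpredT F) (@big_cat_nat _ _ _ k0) //=; last by lia.
  rewrite big_nat big1 ?add0r; last first.
    move=> i /andP[_ ik]; rewrite /F /c.
    by case E : (_ - _ + M) => [k|]; [lia|rewrite mul0r].
  rewrite -{1}[k0]add0n big_addn (_ : (N.*2 - k0)%N = L); last by lia.
  rewrite big_mkord big_distrr; apply: eq_bigr => i _; rewrite /F /c.
  have -> : (i + k0)%N%:Z - N%:Z = - M + i%:Z by lia.
  by rewrite addrAC addNr add0r expfzDr // mulrCA -exprnP.
have -> : u = p%:R ^ (- M) * x.
  by rewrite /x mulrCA -expfzDr // addNr expr0z mulr1.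
rewrite -mulrBr {1}(padic_sum_lead _ _ x L) addrC addKr.
rewrite (exprnP (p%:R : Qp)) mulrA -expfzDr // LE padic_absM padic_abs_expz.
rewrite (_ : - (- M + _) = - N%:Z); last by lia.
by rewrite exprVn -exprnN ler_piMr ?invr_ge0 ?exprn_ge0 ?(ltW pR0) ?y1.
Qed.

Lemma padic_digitP u : padic_expansion u (padic_digit u).
Proof.
by have /(xgetPex (fun=> 0%N)) : exists c, padic_expansion u c
  by exact: padic_expansion_exists.
Qed.

(** Digits vanish below the valuation of [u], so the sum over all exponents n <= 0 may be cut off at
    any -N with |u| < p^N. *)
Lemma padic_floor_sum u : exists N0 : nat, forall N, (N0 <= N)%N ->
  padic_floor u = \sum_(i < N.+1)
    (padic_digit u (i%:Z - N%:Z))%:R * pR ^ (i%:Z - N%:Z).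
Proof.
have [_ c0 _] := padic_digitP u.
(* Adding 1 keeps the inverse positive when u = 0 and makes the later bound strict. *)
have e0 : 0 < (padic_abs u + 1)^-1 by rewrite invr_gt0 ltr_wpDl ?padic_abs_ge0.
have [N0 N0u] := prime_expV_small _ e0; exists N0 => N NN.
have pR1 := prime_ratr_gt1 _ p_pr; have pR0 := prime_ratr_gt0 _ p_pr.
have uN : padic_abs u < pR ^ N%:Z.
  have := N0u _ NN; rewrite exprVn ltf_pV2 ?posrE ?exprn_gt0 //; last first.
    by rewrite ltr_wpDl ?padic_abs_ge0.
  by rewrite -exprnP => uN; apply: lt_trans uN; rewrite ltrDl.
rewrite /padic_floor (fsbigE [seq i%:Z - N%:Z | i <- iota 0 N.+1]).
- rewrite big_map -{1}[N.+1]subn0 -/(index_iota 0 N.+1) big_mkord.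
  by apply: eq_bigl => i; apply/mem_set => /=; have := ltn_ord i; lia.
- by rewrite map_inj_uniq ?iota_uniq // => i j; lia.
- move=> n /mapP[i]; rewrite mem_iota => iN -> /=; lia.
move=> n n0 /negP nN; have {}n0 : n <= 0 := n0; rewrite c0 ?mul0r //; apply: lt_trans uN _.
rewrite ltr_eXz2l //; rewrite ltNge; apply/negP => nle; apply: nN.
by apply/mapP; exists (absz (n + N%:Z)); rewrite ?mem_iota; lia.
Qed.

Lemma padic_floor_near u : padic_abs (u - ratr (padic_floor u)) <= pR^-1.
Proof.
have [_ _ /cvg_ballP cvg] := padic_digitP u.
have pR1 := prime_ratr_gt1 _ p_pr; have pR0 := prime_ratr_gt0 _ p_pr.
have [N1 _ uS] := cvg pR^-1 (ltac:(by rewrite invr_gt0)).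
have [N0 N0u] := padic_floor_sum u.
(* The 1 ensures N + 1 <= 2N, so the floor is an initial segment of the partial sum. *)
pose N := (maxn N0 (maxn N1 1)).
have [NN0 NN1 N_gt0] : [/\ (N0 <= N)%N, (N1 <= N)%N & (0 < N)%N] by rewrite /N; split; lia.
pose F (i : nat) : Qp := (padic_digit u (i%:Z - N%:Z))%:R * p%:R ^ (i%:Z - N%:Z).
have uN : padic_abs (u - \sum_(i < N.*2) F i) < pR^-1 by exact: uS.
have floorE : ratr (padic_floor u) = \sum_(i < N.+1) F i :> Qp.
  rewrite (N0u _ NN0) padic_ratrE rmorph_sum /=; apply: eq_bigr => i _.
  by rewrite rmorphM /= rmorph_nat fmorphXz rmorph_nat.
have NE : (N.+1 <= N.*2)%N by lia.
rewrite floorE -(subrK (\sum_(i < N.*2) F i) u) -addrA.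
apply: padic_absD_le; first exact: ltW.
(* The terms beyond the floor have exponent at least 1, hence absolute value at most 1/p. *)
rewrite -!(big_mkord xpredT F) (@big_cat_nat _ _ _ N.+1) //= addrC addKr.
rewrite big_nat; apply: padic_abs_sum_le; first by rewrite invr_ge0 ltW.
move=> i /andP[Ni _]; rewrite padic_absM padic_abs_nat padic_abs_expz.
rewrite -[leRHS]mul1r -exprN1; apply: ler_pM; rewrite ?padic_absq_ge0 ?exprz_ge0 ?(ltW pR0) //.
  exact: (padic_absq_int _ p_pr (Posz _)).
by rewrite ler_eXz2l //; lia.
Qed.

End PadicFloor.

(** * Size of the complete and partial quotients in Q_p *)

Section ContinuedFraction.
Variables (p : nat) (p_pr : prime p) (R : realType) (K : fieldType).
Variables (sigma_inf : {rmorphism K -> R}) (sigma_p : {rmorphism K -> padic p_pr}).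
Variable alpha : K.
Local Notation Qp := (padic p_pr).
Local Notation pR := (p%:R : rat).
Local Notation ratp := (padic_of_rat p_pr).
Local Notation b_ := (cf_b sigma_inf sigma_p).
Local Notation alpha_ := (cf_alpha sigma_inf sigma_p alpha).
Local Notation M_ := (cf_matrix sigma_inf sigma_p alpha).
Implicit Types (a : K) (n : nat).

Lemma padic_abs_of_rat (q : rat) : padic_abs (ratp q) = padic_absq p q.
Proof. by rewrite -padic_ratrE padic_abs_ratr. Qed.

Lemma cf_b_near (eps : bool) a :
  padic_abs (sigma_p a - ratp (b_ eps a)) <= if eps then 1 else pR^-1.
Proof.
have pV1 : pR^-1 <= 1 by rewrite invf_le1 ?prime_ratr_gt0 // ltW ?prime_ratr_gt1.
have near := padic_floor_near _ p_pr (sigma_p a); rewrite padic_ratrE in near.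
case: eps; rewrite /cf_b /cf_b1 /cf_b0; set m := least_minimizer _;
  rewrite rmorphD /= addrC opprD -addrA [_ + sigma_p a]addrC;
  apply: padic_absD_le; rewrite ?padic_absN ?padic_abs_of_rat ?padic_absqM //.
- exact: padic_absq_int.
- exact: le_trans near _.
- by rewrite padic_absq_prime // ler_piMl ?padic_absq_int // invr_ge0 ltW ?prime_ratr_gt0.
Qed.

(** Carries one step of the algorithm over to Q_p: [sigma_p] is injective and fixes the
    rationals. *)
Lemma cf_alphaS n a' : alpha_ n.+1 = Some a' -> exists2 a, alpha_ n = Some a &
  sigma_p a - ratp (b_ (odd n) a) != 0 /\
  sigma_p a' = (sigma_p a - ratp (b_ (odd n) a))^-1.
Proof.
rewrite /=; case: (alpha_ n) => [a|//] /=; rewrite /cf_F; case: eqVneq => // ab [<-].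
exists a => //; rewrite -padic_ratrE -(fmorph_rat sigma_p) -rmorphB.
by rewrite fmorph_eq0 subr_eq0 fmorphV.
Qed.

Lemma cf_alpha_abs n a : alpha_ n.+1 = Some a ->
  (if odd n then 1 else pR) <= padic_abs (sigma_p a).
Proof.
move=> /cf_alphaS[c _ [cb0 ->]]; rewrite padic_absV.
have := cf_b_near (odd n) c.
have : 0 < padic_abs (sigma_p c - ratp (b_ (odd n) c)).
  by rewrite lt_def padic_abs_eq0 cb0 padic_abs_ge0.
case: odd => x0 xle; first by rewrite invf_ge1.
by rewrite -[leLHS]invrK lef_pV2 ?posrE ?invr_gt0 ?prime_ratr_gt0.
Qed.

(** The isosceles principle applies in both parities: the distance to the partial quotient is at
    most 1/p < 1 at even indices and at most 1 < p at odd ones. *)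
Lemma cf_partial_abs n a : alpha_ n.+1 = Some a ->
  (if odd n then 1 else pR) <= padic_absq p (b_ (odd n.+1) a).
Proof.
move=> /cf_alpha_abs a1; rewrite -(padic_abs_of_rat (b_ _ _)).
rewrite (padic_abs_eq_of_lt _ _ (sigma_p a)) //; apply: lt_le_trans a1.
apply: le_lt_trans (cf_b_near _ _) _; have := prime_ratr_gt1 _ p_pr.
by rewrite /=; case: odd => //= p1; rewrite invf_lt1 // (lt_trans ltr01).
Qed.

(** * Recurrences, errors and denominators of the convergents *)

Lemma cf_matrix0 : M_ 0 = cf_step (b_ false alpha).
Proof. by rewrite /cf_matrix big_ord_recl big_ord0 mulr1. Qed.

Lemma cf_matrixS0 n a i : alpha_ n.+1 = Some a ->
  M_ n.+1 i 0 = M_ n i 0 * b_ (odd n.+1) a + M_ n i 1.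
Proof.
move=> na; rewrite /cf_matrix big_ord_recr /= -/(M_ n) mxE !big_ord_recl big_ord0.
rewrite /cf_partial na !mxE /= addr0 mulr1.
by congr (_ + M_ n i _); apply: val_inj.
Qed.

Lemma cf_matrixS1 n i : M_ n.+1 i 1 = M_ n i 0.
Proof.
rewrite /cf_matrix big_ord_recr /= -/(M_ n) mxE !big_ord_recl big_ord0.
by rewrite !mxE /= mulr1 mulr0 !addr0.
Qed.

(* Column 0 is alpha q_n - p_n, column 1 is alpha q_(n-1) - p_(n-1). *)
Let err n (j : 'I_2) : Qp := sigma_p alpha * ratp (M_ n 1 j) - ratp (M_ n 0 j).

Lemma cf_errE n a : alpha_ n = Some a ->
  err n 0 = (ratp (b_ (odd n) a) - sigma_p a) * err n 1.
Proof.
elim: n a => [|n IHn] a.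
  move=> [<-]; rewrite /err cf_matrix0 !mxE /= rmorph1 rmorph0.
  by rewrite mulr1 mulr0 sub0r mulrN1 opprB.
move=> na; have [c /IHn IHc [cb0 ->]] := cf_alphaS _ _ na.
have -> : err n.+1 1 = err n 0 by rewrite /err !cf_matrixS1.
have -> : err n.+1 0 = ratp (b_ (odd n.+1) a) * err n 0 + err n 1.
  rewrite /err !(cf_matrixS0 _ _ _ na) !rmorphD !rmorphM /=.
  have affine (F : comNzRingType) (x b q q' r r' : F) :
    x * (q * b + q') - (r * b + r') = b * (x * q - r) + (x * q' - r') by ring.
  exact: affine.
(* It remains to see that the previous-column error is minus the new complete quotient times
   [err n 0], which is the induction hypothesis divided by its nonzero factor. *)
rewrite mulrBl; congr (_ + _); rewrite IHc mulrA.
by rewrite -[_ - sigma_p c]opprB mulrN mulVf // mulN1r opprK.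
Qed.

Lemma cf_err_le1 n a : alpha_ n = Some a -> padic_abs (err n 0) <= 1.
Proof.
have err01 m c : alpha_ m = Some c -> padic_abs (err m 0) <= padic_abs (err m 1).
  move=> mc; rewrite (cf_errE _ _ mc) padic_absM padic_abs_subC.
  rewrite ler_piMl ?padic_abs_ge0 //; apply: le_trans (cf_b_near _ _) _.
  by case: odd => //; rewrite invf_le1 ?prime_ratr_gt0 // ltW ?prime_ratr_gt1.
elim: n a => [|n IHn] a na; apply: le_trans (err01 _ _ na) _.
  (* The chain of inequalities ends at [err 0 1], which is -1 because p_(-1) = 1 and q_(-1) = 0. *)
  by rewrite /err cf_matrix0 !mxE /= rmorph1 rmorph0 mulr0 sub0r padic_absN padic_abs1.
by have [c /IHn + _] := cf_alphaS _ _ na; rewrite /err !cf_matrixS1.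
Qed.

(** The strict inequality at odd [n] is carried through the induction because the next partial
    quotient, of even index, is only known to have absolute value at least 1; after an even [n] the
    next one contributes a factor p. *)
Lemma cf_den_growth n a : alpha_ n = Some a ->
  [/\ padic_absq p (M_ n 1 1) <= padic_absq p (M_ n 1 0),
      odd n -> padic_absq p (M_ n 1 1) < padic_absq p (M_ n 1 0) &
      pR ^+ uphalf n <= padic_absq p (M_ n 1 0)].
Proof.
have p1 := prime_ratr_gt1 _ p_pr; have p0 := prime_ratr_gt0 _ p_pr.
elim: n a => [a _|n IHn a na].
  by rewrite cf_matrix0 !mxE /= padic_absq0 padic_absq1 //.
have [c /IHn[le lt gr] _] := cf_alphaS _ _ na.
rewrite (cf_matrixS0 _ _ _ na) cf_matrixS1; have := cf_partial_abs _ _ na.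
set b := b_ _ _ => b1.
have Q0 : 0 < padic_absq p (M_ n 1 0) by apply: lt_le_trans gr; rewrite exprn_gt0.
have [Q'lt bQ] : padic_absq p (M_ n 1 1) < padic_absq p (M_ n 1 0 * b) /\
    (if odd n then 1 else pR) * padic_absq p (M_ n 1 0) <= padic_absq p (M_ n 1 0 * b).
  rewrite padic_absqM // [X in _ < X]mulrC [X in _ <= X]mulrC ler_pM2r //; split=> //.
  case: (boolP (odd n)) b1 => on b1.
    by apply: lt_le_trans (lt on) _; rewrite ler_peMl // ltW.
  by apply: le_lt_trans le _; rewrite ltr_pMl // (lt_le_trans p1).
(* The product strictly dominates q_(n-1), so it alone determines the absolute value of the new
   denominator. *)
rewrite (padic_absq_eq p_pr (a := M_ n 1 0 * b + M_ n 1 1) (b := M_ n 1 0 * b));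
  last by rewrite addrAC subrr add0r.
(* [uphalf] grows by one exactly when [n] is even, which is when the factor p appears. *)
have pn : pR ^+ uphalf n.+1 <= (if odd n then 1 else pR) * padic_absq p (M_ n 1 0).
  rewrite /= uphalf_half in gr *; case: odd gr => /= gr.
    by rewrite mul1r.
  by rewrite exprS ler_pM2l.
split; last exact: le_trans pn bQ.
  by apply: le_trans bQ; case: odd; rewrite ?mul1r // ler_peMl // ltW.
by move=> /= on; apply: lt_le_trans bQ; rewrite (negPf on) ltr_pMl.
Qed.

Lemma cf_den_neq0 n a : alpha_ n = Some a -> M_ n 1 0 != 0.
Proof.
move=> /cf_den_growth[_ _]; apply: contraTneq => ->.
by rewrite padic_absq0 -ltNge exprn_gt0 ?prime_ratr_gt0.
Qed.

Lemma cf_conv_err n a : alpha_ n = Some a ->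
  sigma_p alpha - ratr (M_ n 0 0 / M_ n 1 0) = err n 0 / ratp (M_ n 1 0).
Proof.
move=> /cf_den_neq0 Q0; rewrite padic_ratrE fmorph_div mulrBl mulfK //.
by rewrite fmorph_eq0.
Qed.

Lemma cf_conv_near n a : alpha_ n = Some a ->
  padic_abs (sigma_p alpha - ratr (M_ n 0 0 / M_ n 1 0)) <= pR^-1 ^+ uphalf n.
Proof.
move=> na; rewrite (cf_conv_err _ _ na) padic_absM padic_absV padic_abs_of_rat.
have [_ _ Qn] := cf_den_growth _ _ na.
have pn : 0 < pR ^+ uphalf n by rewrite exprn_gt0 ?prime_ratr_gt0.
rewrite -[leRHS]mul1r exprVn; apply: ler_pM; rewrite ?padic_abs_ge0 ?invr_ge0 ?padic_absq_ge0 //.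
  exact: cf_err_le1 na.
by rewrite lef_pV2 ?posrE // (lt_le_trans pn).
Qed.

Lemma cf_conv_halt n a : alpha_ n = Some a -> alpha_ n.+1 = None ->
  ratr (M_ n 0 0 / M_ n 1 0) = sigma_p alpha.
Proof.
move=> na; rewrite /= na /= /cf_F; case: eqP => // ab _.
have {}ab : sigma_p a = ratp (b_ (odd n) a).
  by rewrite -padic_ratrE -(fmorph_rat sigma_p) -ab.
apply/esym/eqP; rewrite -subr_eq0 (cf_conv_err _ _ na) (cf_errE _ _ na) ab.
by rewrite subrr !mul0r.
Qed.

End ContinuedFraction.

Theorem corollary2p13 (p : nat) (p_pr : prime p) (R : realType) (K : fieldType)
    (sigma_inf : {rmorphism K -> R}) (sigma_p : {rmorphism K -> padic p_pr})
    (alpha : K) :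
  let alpha_ := cf_alpha sigma_inf sigma_p alpha in
  let p_ := cf_num sigma_inf sigma_p alpha in
  let q_ := cf_den sigma_inf sigma_p alpha in
  let conv (n : nat) : padic p_pr := ratr (p_ n / q_ n) in
  ((forall n, alpha_ n <> None) -> conv @ \oo --> sigma_p alpha) /\
  (forall N, alpha_ N <> None -> alpha_ N.+1 = None -> conv N = sigma_p alpha).
Proof.
move=> alpha_ p_ q_ conv; split=> [alphaN|N]; last first.
  by case E : (alpha_ N) => [a|//] _; exact: cf_conv_halt E.
apply/cvg_ballP => e e0; have [N Ne] := prime_expV_small _ p_pr _ e0.
(* The rank is doubled because the exponent in the error bound is [uphalf n]. *)
exists N.*2 => // n /= Nn; rewrite /ball /= /padic_ball /=.
case E : (alpha_ n) (alphaN n) => [a|//] _.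
apply: le_lt_trans (cf_conv_near _ _ _ _ _ _ _ _ _ E) (Ne _ _); lia.
Qed.
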